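(* Let $\Delta$ be a positive integer and let $H$ be a countably infinite graph with maximum degree at most $\Delta$. Then $\rho(H)\geq 1/(2\Delta)$.
   Context: Let $K_{\mathbb{N}}$ be the complete graph on the natural numbers $\mathbb{N}=\{1,2,\dots\}$, and $[n]=\{1,\dots,n\}$. For $S\subseteq\mathbb{N}$ the (upper) density is $\bar d(S)=\limsup_{n\to\infty}|S\cap[n]|/n$, and for a subgraph $H'\subseteq K_{\mathbb{N}}$ we set $\bar d(H')=\bar d(V(H'))$. For a countably infinite graph $H$ (vertex set of the same cardinality as $\mathbb{N}$), the Ramsey upper density $\rho(H)$ is the supremum of the values $\lambda$ for which, for every two-coloring of $E(K_{\mathbb{N}})$, there exists a monochromatic (not necessarily induced) subgraph $H'\subseteq K_{\mathbb{N}}$, isomorphic to $H$, with $\bar d(H')\geq\lambda$. *)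

(* Defs.v *)
From HB Require Import structures.
From mathcomp Require Import all_boot all_order all_algebra finmap.
From mathcomp Require Import all_classical all_reals all_analysis.

Set Implicit Arguments.
Unset Strict Implicit.
Unset Printing Implicit Defensive.

Import Order.TTheory GRing.Theory Num.Theory.

Local Open Scope classical_set_scope.
Local Open Scope card_scope.
Local Open Scope ring_scope.

Record graph (V : Type) := Graph {
  adj : V -> V -> Prop;
  adj_sym : forall x y, adj x y -> adj y x;
  adj_irrefl : forall x, ~ adj x x }.

Definition countably_infinite (V : Type) : Prop := [set: V] #= [set: nat].

Definition max_degree_le (V : Type) (H : graph V) (D : nat) : Prop :=
  forall x, [set y | adj H x y] #<= `I_D.

(* The vertices of the complete graph K_N are the positive elements of [nat]. *)
Record subgraphKN := SubgraphKN {
  verts : set nat;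
  edge : nat -> nat -> Prop;
  verts_gt0 : forall x, verts x -> (0 < x)%N;
  edge_sym : forall x y, edge x y -> edge y x;
  edge_irrefl : forall x, ~ edge x x;
  edge_verts : forall x y, edge x y -> verts x /\ verts y }.

(* The color of the edge {x, y} is [c x y]; the values of [c] on the diagonal
   and at 0 carry no meaning and are never used. *)
Record two_coloring := TwoColoring {
  color :> nat -> nat -> bool;
  color_sym : forall x y, color x y = color y x }.

Definition monochromatic (c : two_coloring) (G : subgraphKN) : Prop :=
  exists b : bool, forall x y, edge G x y -> c x y = b.

Definition isomorphic (V : Type) (H : graph V) (G : subgraphKN) : Prop :=
  exists f : V -> nat, set_bij [set: V] (verts G) f /\
    forall x y, adj H x y <-> edge G (f x) (f y).

(* The limsup does not see the term n = 0, where the quotient is 0 / 0 = 0. *)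
Definition upper_density (R : realType) (S : set nat) : \bar R :=
  limn_esup (fun n : nat =>
    ((#|` fset_set (S `&` [set k | (1 <= k <= n)%N])|)%:R / n%:R : R)%:E).

Definition ramsey_upper_density (R : realType) (V : Type) (H : graph V)
    : \bar R :=
  ereal_sup [set l : \bar R | forall c : two_coloring,
    exists G : subgraphKN,
      [/\ monochromatic c G, isomorphic H G &
          (l <= upper_density R (verts G))%E]].

(* Main.v *)
Require Import Defs.
From mathcomp Require Import all_boot all_order all_algebra finmap.
From mathcomp Require Import all_classical all_reals all_analysis.
From mathcomp Require Import zify.

Set Implicit Arguments.
Unset Strict Implicit.
Unset Printing Implicit Defensive.

Import Order.TTheory GRing.Theory Num.Theory.

Local Open Scope classical_set_scope.
Local Open Scope card_scope.
Local Open Scope nat_scope.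

(** Write D for Delta.  Colour H greedily with the colours 0, ..., D; one of
    its colour classes is infinite, and after renaming this is the class D.

    Every free ultrafilter U on the positive integers splits them in two: the
    vertices v whose red neighbourhood belongs to U, and those whose blue
    neighbourhood does.  Finitely many vertices of the same kind have a common
    neighbourhood of that colour in U, which leaves room for a further vertex.
    Iterating this idea gives a [tower] of height D in colour b over P: sets
    T_0, ..., T_(D-1), T_D = P and free filters U_0, ..., U_(D-1) with T_i in
    U_i, such that each vertex of T_j is joined in colour b to U_i-almost all
    vertices whenever i < j.

    A tower of height D over an infinite set P yields a copy of H in colour b
    whose vertex set contains P ([tower_embedding]).  Vertices of colour i < D go
    into T_i, each one after its neighbours of higher colour; a vertex of
    colour D goes to the least vertex of P that is still free, and as the class
    D is infinite, all of P gets covered.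

    It remains to find such a tower over a set P of upper density at least
    1/(2D) ([often_dense_tower]).  Suppose that an infinite set S carries a
    tower of height r < D in red and one of height s < D in blue, and let U be a
    free ultrafilter containing S.  One of the two parts into which U splits S
    belongs to U, and that part, with U repeated D times, carries a tower of
    height D in its own colour.  The other part extends the tower over S of the
    other colour by one level.  Starting from all positive integers with
    r = s = 0, this splits off at most 2D - 1 parts before one of the heights
    reaches D or a finite set remains.  So the positive integers are, up to a
    finite set, the union of at most 2D sets that carry a tower of height D, and
    one of these has upper density at least 1/(2D). *)

(** * Greedy constructions on a graph of bounded degree *)

(** Dependent choice in which the admissibility of a term is a condition on the
    list of all previous terms. *)
Lemma greedy_sequence (A : Type) (x0 : A) (Q : seq A -> A -> Prop) :
  (forall e n, (forall m, m < n -> Q (mkseq e m) (e m)) ->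
     exists x, Q (mkseq e n) x) ->
  exists e, forall n, Q (mkseq e n) (e n).
Proof.
move=> step.
have /choice[h hP] : forall s, exists x, (exists y, Q s y) -> Q s x.
  move=> s; have [[y Qy]|nQ] := pselect (exists y, Q s y); first by exists y.
  by exists x0.
pose pre n := iter n (fun s => rcons s (h s)) [::].
pose e n := h (pre n).
have preE n : pre n = mkseq e n.
  by elim: n => [//|n IHn]; rewrite mkseqS -IHn.
exists e; elim/ltn_ind => n IHn.
by rewrite {2}/e preE; apply: hP; apply: step.
Qed.

Section BoundedDegree.
Variables (adj : nat -> nat -> Prop) (nb : nat -> seq nat) (D : nat).
Hypothesis nbP : forall x y, adj x y <-> y \in nb x.
Hypothesis nb_size : forall x, size (nb x) <= D.
Hypothesis adjC : forall x y, adj x y -> adj y x.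

Lemma proper_coloring : exists col : nat -> nat,
  (forall x, col x <= D) /\ forall x y, x < y -> adj x y -> col x != col y.
Proof.
pose Q (s : seq nat) (a : nat) := a <= D /\
  forall m, m < size s -> adj m (size s) -> nth 0 s m != a.
have [|col colP] := @greedy_sequence nat 0 Q.
  move=> e n _; pose used := [seq nth 0 (mkseq e n) m | m <- nb n].
  have [a aD anu] : exists2 a, a <= D & a \notin used.
    apply: contrapT => noa.
    have : size (iota 0 D.+1) <= size used.
      apply: uniq_leq_size; first exact: iota_uniq.
      move=> a; rewrite mem_iota add0n ltnS => /andP[_ aD].
      by apply: contraT => anu; case: noa; exists a.
    by rewrite size_iota size_map leqNgt ltnS nb_size.
  exists a; split=> // m; rewrite size_mkseq => mn mE.
  apply: contraNneq anu => <-; apply: map_f.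
  by apply/nbP/adjC.
exists col; split=> [x|x y xy xEy]; first by have [] := colP x.
have [_ /(_ x)] := colP y.
by rewrite size_mkseq nth_mkseq//; exact.
Qed.

(** The largest value of y plus the number of steps from x to y, over the vertices
    y reached from x by at most d steps to a neighbour of higher colour. *)
Fixpoint chain_bound (col : nat -> nat) (d x : nat) : nat :=
  if d is d'.+1 then
    maxn x (\max_(y <- nb x | col x < col y) (chain_bound col d' y).+1)
  else x.

Lemma chain_boundS col d x :
  chain_bound col d x <= chain_bound col d.+1 x.
Proof.
elim: d x => [|d IHd] x; first by rewrite /= leq_maxl.
rewrite [leqRHS]/= [leqLHS]/= geq_max leq_maxl /=.
apply: leq_trans (leq_maxr _ _).
apply/bigmax_leqP_seq => y ynb xy.
apply: leq_trans (leq_bigmax_seq _ ynb xy).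
by rewrite ltnS; exact: IHd.
Qed.

(** The map K is a time schedule for embedding the vertices; times that are not
    values of K remain idle.  As colours are at most D, at most D - col x steps
    upwards are possible from x, and [chain_bound] for that number strictly drops
    from x to its neighbours of higher colour.  It is at least x, so squaring it
    and adding x separates ties without disturbing the order. *)
Lemma higher_color_first (col : nat -> nat) : (forall x, col x <= D) ->
  exists K : nat -> nat, injective K /\
    forall x y, adj x y -> col x < col y -> K y < K x.
Proof.
move=> colD; pose L x := chain_bound col (D - col x) x.
have leL x : x <= L x by rewrite /L; case: (D - col x) => //= d; rewrite leq_maxl.
have chain_bound_le d d' x : d <= d' -> chain_bound col d x <= chain_bound col d' x.
  move=> /subnK <-; elim: (d' - d) => // k IHk.
  by rewrite addSn (leq_trans IHk)// chain_boundS.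
have L_lt x y : adj x y -> col x < col y -> L y < L x.
  move=> xEy cxy; have cyD := colD y.
  rewrite /L; have -> : D - col x = (D - (col x).+1).+1 by lia.
  rewrite [ltnRHS]/=; apply: leq_trans (leq_maxr _ _).
  have ynb : y \in nb x by apply/nbP.
  apply: leq_trans (leq_bigmax_seq _ ynb cxy).
  by rewrite ltnS; apply: chain_bound_le; lia.
have sqr_gap x y : L x < L y -> L x * L x + x < L y * L y + y.
  by move=> Lxy; have := leq_mul Lxy Lxy; have := leL x; lia.
exists (fun x => L x * L x + x); split=> [x y Kxy|x y xEy cxy].
- by case: (ltngtP (L x) (L y)) => [/sqr_gap|/sqr_gap|Lxy]; lia.
- by apply/sqr_gap/L_lt.
Qed.

End BoundedDegree.

Lemma infinite_top_color (adj : nat -> nat -> Prop) (nb : nat -> seq nat) D :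
  (forall x y, adj x y <-> y \in nb x) -> (forall x, size (nb x) <= D) ->
  (forall x y, adj x y -> adj y x) -> (forall x, ~ adj x x) ->
  exists col : nat -> nat, [/\ forall x, col x <= D,
    forall x y, adj x y -> col x != col y & infinite_set [set x | col x = D]].
Proof.
move=> nbP nbD adjC adjI.
have [col [colD col_ne]] := proper_coloring nbP nbD adjC.
have {}col_ne x y : adj x y -> col x != col y.
  move=> xEy; have [xy|yx|exy] := ltngtP x y.
  - exact: col_ne.
  - by rewrite eq_sym; apply: col_ne => //; exact: adjC.
  - by case: (adjI x); rewrite {2}exy.
have [i iD iinf] : exists2 i, i <= D & infinite_set [set x | col x = i].
  apply: contrapT => noi; apply: infinite_nat.
  apply: (@sub_finite_set _ _ (\bigcup_(i in `I_D.+1) [set x | col x = i])).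
    by move=> x _; exists (col x) => //=; rewrite ltnS.
  apply: bigcup_finite; first exact: finite_II.
  move=> i /=; rewrite ltnS => iD; apply: contrapT => iinf; apply: noi.
  by exists i.
pose swap j := if j == i then D else if j == D then i else j.
have swap_inj : injective swap.
  by move=> j k; rewrite /swap; do 4?case: eqP => ?; lia.
exists (fun x => swap (col x)); split.
- by move=> x; rewrite /swap; do 2?case: ifP => //.
- by move=> x y /col_ne; apply: contraNneq => /swap_inj ->.
- apply: sub_infinite_set iinf => x /= ->.
  by rewrite /swap eqxx.
Qed.

(** * Towers of filters *)

(** T and U are total functions, of which the levels 0 to a and 0 to a - 1 count;
    this way a tower grows by overriding single values. *)
Definition tower (c : two_coloring) (b : bool) (a : nat) (P : set nat) :=
  exists (T : nat -> set nat) (U : nat -> set_system nat), [/\ T a = P,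
    forall i, i < a -> [/\ ProperFilter (U i), \oo `<=` U i & U i (T i)]
    & forall i j v, i < j -> j <= a -> T j v -> U i [set w | c v w = b]].

Lemma tower0 (c : two_coloring) b P : tower c b 0 P.
Proof.
exists (fun=> P), (fun=> \oo); split=> // i j v ij j0.
by have := leq_trans ij j0.
Qed.

Lemma sub_tower (c : two_coloring) b a P P' :
  P' `<=` P -> tower c b a P -> tower c b a P'.
Proof.
move=> sP [T [U [TP UT TU]]].
exists (fun i => if i == a then P' else T i), U; split; first by rewrite eqxx.
- by move=> i ia; rewrite ltn_eqF//; apply: UT.
- move=> i j v ij ja; case: eqP => [ja'|_]; last exact: TU.
  by move=> /sP; rewrite -TP => ?; apply: (TU _ a) => //; rewrite -ja'.
Qed.

(** The set S on which the given tower stands becomes its level a, and U the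
    filter of that level. *)
Lemma towerS (c : two_coloring) b a S P (U : set_system nat) :
  ProperFilter U -> \oo `<=` U -> U S -> P `<=` S ->
  (forall v, P v -> U [set w | c v w = b]) ->
  tower c b a S -> tower c b a.+1 P.
Proof.
move=> UF Uoo US sPS PU [T [U' [TS UT TU]]].
exists (fun i => if i == a.+1 then P else T i),
  (fun i => if i == a then U else U' i); split; first by rewrite eqxx.
- move=> i; rewrite ltnS leq_eqVlt => /orP[/eqP ->|ia].
    by rewrite eqxx ltn_eqF// TS; split.
  have -> : (i == a.+1) = false by lia.
  by rewrite ltn_eqF//; exact: UT.
- move=> i j v; case: (eqVneq j a.+1) => [-> ia1 _ Pv|ja ij].
    case: eqVneq => [_|ia]; first exact: PU.
    by apply: (TU i a); rewrite ?TS//; [lia|exact: sPS].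
  move=> jaS; have -> : (i == a) = false by lia.
  by apply: TU => //; lia.
Qed.

(** A set that belongs to a filter, all of whose vertices have their
    neighbourhoods in that same filter, can serve as every level at once. *)
Lemma const_tower (c : two_coloring) b a (P : set nat) (U : set_system nat) :
  ProperFilter U -> \oo `<=` U -> U P ->
  (forall v, P v -> U [set w | c v w = b]) -> tower c b a P.
Proof.
by move=> UF Uoo UP PU; exists (fun=> P), (fun=> U); split=> // i j v _ _; apply: PU.
Qed.

(** * Embedding along a tower *)

(** The sequence e lists the images in the order given by K, with the value 0 at
    idle times: 0 lies outside P, so idle times use up no vertex to be covered.
    A vertex of colour i < D has, at its time, finitely many
    embedded neighbours, all of higher colour, hence in levels above i; their
    common neighbourhood in colour b belongs to U_i and so meets T_i outside any
    finite set. *)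
Lemma tower_embedding (c : two_coloring) b D P (adj : nat -> nat -> Prop)
    (col K : nat -> nat) :
  (forall x y, adj x y -> adj y x) ->
  (forall x, col x <= D) -> (forall x y, adj x y -> col x != col y) ->
  infinite_set [set x | col x = D] ->
  injective K -> (forall x y, adj x y -> col x < col y -> K y < K x) ->
  infinite_set P -> (forall p, P p -> 0 < p) -> tower c b D P ->
  exists f : nat -> nat, [/\ injective f, forall x, 0 < f x, P `<=` range f
    & forall x y, adj x y -> c (f x) (f y) = b].
Proof.
move=> adjC colD col_ne topinf K_inj K_lt Pinf Ppos [T [U [TP UT TU]]].
pose Q (s : seq nat) p :=
  (forall x, K x = size s -> [/\ 0 < p, p \notin s, T (col x) p,
    col x = D -> forall q, P q -> q \notin s -> p <= q
    & forall y, K y < size s -> adj y x -> c (nth 0 s (K y)) p = b]) /\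
  ((forall x, K x <> size s) -> p = 0).
have col_lt x y : K y < K x -> adj y x -> col x < col y.
  move=> yx yEx; rewrite ltn_neqAle eq_sym col_ne//= leqNgt.
  by apply/negP => /(K_lt _ _ yEx); rewrite ltnNge ltnW.
have [|e eP] := @greedy_sequence nat 0 Q.
  move=> e n prev; rewrite /Q size_mkseq.
  have [[x Kx]|nK] := pselect (exists x, K x = n); last first.
    exists 0; split=> // x Kx.
    by case: nK; exists x.
  suff [p pP] : exists p, [/\ 0 < p, p \notin mkseq e n, T (col x) p,
      col x = D -> forall q, P q -> q \notin mkseq e n -> p <= q
      & forall y, K y < n -> adj y x -> c (e (K y)) p = b].
    exists p; split=> [x'|/(_ x)//]; rewrite -Kx => /K_inj ->.
    rewrite Kx; case: pP => *; split=> // y yn.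
    by rewrite nth_mkseq//; auto.
  have [cD|cD] := eqVneq (col x) D.
    have exP : exists p, `[< P p >] && (p \notin mkseq e n).
      apply: contrapT => nex; apply: Pinf.
      apply: (@sub_finite_set _ _ [set` mkseq e n]) => [p Pp /=|]; last first.
        exact: finite_seq.
      by apply: contraT => ps; case: nex; exists p; rewrite asboolT.
    case: (ex_minnP exP) => p /andP[/asboolP Pp ps] pmin.
    exists p; split=> // [||_ q Pq qs|y yn yEx].
    - exact: Ppos.
    - by rewrite cD TP.
    - by apply: pmin; rewrite asboolT.
    - by have := col_lt x y; rewrite Kx => /(_ yn yEx); rewrite cD ltnNge colD.
  have {}cD : col x < D by rewrite ltn_neqAle cD colD.
  have [UF Uoo UTi] := UT _ cD.
  have Uc k : k <= n -> U (col x)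
      [set p | forall y, K y < k -> adj y x -> c (e (K y)) p = b].
    elim: k => [|k IHk] kn; first by apply: filterE => p y.
    have Uk : U (col x) [set p | forall y, K y = k -> adj y x -> c (e k) p = b].
      have [[y Ky yEx]|nky] := pselect (exists2 y, K y = k & adj y x); last first.
        by apply: filterE => p y Ky yEx; case: nky; exists y.
      have [/(_ y)] := prev _ kn; rewrite size_mkseq => /(_ Ky) [_ _ Tk _ _] _.
      have yx : col x < col y by apply: col_lt => //; rewrite Ky Kx.
      by apply: filterS (TU _ _ _ yx (colD y) Tk) => p cp _ _ _.
    apply: filterS2 (IHk (ltnW kn)) Uk => p plt pk y.
    rewrite ltnS leq_eqVlt => /orP[/eqP Ky|]; last exact: plt.
    by rewrite Ky; exact: pk.
  have Ubig : U (col x) [set p | \max_(q <- mkseq e n) q < p].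
    by apply: Uoo; exact: nbhs_infty_gt.
  have [p [[Tp /= cp] /= pbig]] :=
    filter_ex (filterI (filterI UTi (Uc n (leqnn n))) Ubig).
  exists p; split=> //.
  - exact: leq_ltn_trans pbig.
  - apply/negP => ps; move: pbig.
    by rewrite ltnNge (leq_bigmax_seq p ps isT).
  - by move=> cxD; rewrite cxD ltnn in cD.
have embP x : [/\ 0 < e (K x), e (K x) \notin mkseq e (K x),
    col x = D -> forall q, P q -> q \notin mkseq e (K x) -> e (K x) <= q
    & forall y, K y < K x -> adj y x -> c (e (K y)) (e (K x)) = b].
  have [/(_ x)] := eP (K x); rewrite size_mkseq => /(_ erefl)[? ? ? ? eA] _.
  by split=> // y yx; have := eA y yx; rewrite nth_mkseq.
have e0 n : (forall x, K x <> n) -> e n = 0.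
  by have [_] := eP n; rewrite /Q size_mkseq.
have f_inj : injective (e \o K).
  suff ne x y : K x < K y -> e (K x) != e (K y).
    move=> x y /= exy; apply: K_inj.
    by case: (ltngtP (K x) (K y)) => // /ne; rewrite exy eqxx.
  move=> xy; have [_ + _ _] := embP y; apply: contraNneq => <-.
  by rewrite map_f// mem_iota.
exists (e \o K); split=> //=.
- by move=> x; case: (embP x).
(* Were p missed, it would stay free forever, and every vertex of colour D
   would be sent to one of 0, ..., p. *)
- move=> p Pp; apply: contrapT => nep; apply: topinf.
  apply: (@sub_finite_set _ _ ((e \o K) @^-1` `I_p.+1)).
    move=> x /= cx; have [_ _ + _] := embP x.
    move=> /(_ cx p Pp); rewrite ltnS; apply.
    apply/negP => /mapP[m _ pm].
    have [[y Ky]|nK] := pselect (exists y, K y = m).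
      by apply: nep; exists y => //=; rewrite Ky.
    have em0 : e m = 0 by apply: e0 => y Ky; apply: nK; exists y.
    by have := Ppos _ Pp; rewrite pm em0.
  apply: finite_preimage; last exact: finite_II.
  by move=> x y _ _; exact: f_inj.
- move=> x y xEy; have [xy|yx|/K_inj exy] := ltngtP (K x) (K y).
  + by have [_ _ _] := embP y; apply.
  + by rewrite color_sym; have [_ _ _] := embP x; apply=> //; exact: adjC.
  + by have := col_ne _ _ xEy; rewrite exy eqxx.
Qed.

Lemma tower_covered_by_copy (c : two_coloring) b (adj : nat -> nat -> Prop)
    (nb : nat -> seq nat) D P :
  (forall x y, adj x y <-> y \in nb x) -> (forall x, size (nb x) <= D) ->
  (forall x y, adj x y -> adj y x) -> (forall x, ~ adj x x) ->
  infinite_set P -> (forall p, P p -> 0 < p) -> tower c b D P ->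
  exists f : nat -> nat, [/\ injective f, forall x, 0 < f x, P `<=` range f
    & forall x y, adj x y -> c (f x) (f y) = b].
Proof.
move=> nbP nbD adjC adjI Pinf Ppos tP.
have [col [colD col_ne topinf]] := infinite_top_color nbP nbD adjC adjI.
have [K [K_inj K_lt]] := higher_color_first nbP colD.
exact: (tower_embedding adjC colD col_ne topinf K_inj K_lt Pinf Ppos tP).
Qed.

(** * Upper density *)

Definition initial_count (S : set nat) n := count (fun k => `[< S k >]) (iota 1 n).

(** The proportion of S among the first n positive integers is at least N / q for
    infinitely many n.  This forces upper density at least N / q, and it passes
    to one of the two parts of a union, with N shared out between them, by
    counting alone. *)
Definition often_dense q N S :=
  forall n0, exists2 n, n0 < n & N * n <= q * initial_count S n.

Lemma often_denseU q M N A B :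
  often_dense q (M + N) (A `|` B) -> often_dense q M A \/ often_dense q N B.
Proof.
move=> AB; apply: contrapT => /not_orP[/existsNP[n1 nA] /existsNP[n2 nB]].
have [n n12] := AB (n1 + n2); apply/negP; rewrite -ltnNge.
have countU : initial_count (A `|` B) n <= initial_count A n + initial_count B n.
  rewrite /initial_count; elim: (iota 1 n) => //= k s IHs.
  rewrite (_ : `[< _ >] = `[< A k >] || `[< B k >]); last exact: asbool_or.
  by case: `[< A k >]; case: `[< B k >] => /=; lia.
have nAn : q * initial_count A n < M * n.
  by rewrite ltnNge; apply: contra_notN nA => h; exists n => //; lia.
have nBn : q * initial_count B n < N * n.
  by rewrite ltnNge; apply: contra_notN nB => h; exists n => //; lia.
by nia.
Qed.

Lemma often_dense_infinite q N S : 0 < N -> often_dense q N S -> infinite_set S.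
Proof.
move=> N0 lS /finite_seqP[s Ss].
have count_le n : initial_count S n <= size s.
  rewrite /initial_count -size_filter; apply: uniq_leq_size.
    exact/filter_uniq/iota_uniq.
  by move=> k; rewrite mem_filter => /andP[/asboolP]; rewrite Ss.
by have [n] := lS (q * size s); have := count_le n; nia.
Qed.

Lemma often_dense_positives q : often_dense q q [set k | 0 < k].
Proof.
move=> n0; exists n0.+1 => //; rewrite leq_mul2l; apply/orP; right.
rewrite /initial_count -size_filter (_ : [seq _ <- _ | _] = iota 1 n0.+1) ?size_iota//.
by apply/all_filterP/allP => k; rewrite mem_iota => /andP[k0 _]; exact: asboolT.
Qed.

(** The number N + a true + a false stays equal to 2D: each round takes a part
    of density 1/(2D) off S and raises one of the two heights. *)
Lemma often_dense_tower (c : two_coloring) D : 0 < D ->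
  exists b P, [/\ forall x, P x -> 0 < x, often_dense (2 * D) 1 P & tower c b D P].
Proof.
move=> D0.
suff step N (a : bool -> nat) S : (forall b, a b <= D) -> 0 < N ->
    N + a true + a false = 2 * D -> often_dense (2 * D) N S ->
    (forall b, tower c b (a b) S) ->
    exists b P, [/\ P `<=` S, often_dense (2 * D) 1 P & tower c b D P].
  have D2 : 0 < 2 * D by lia.
  have a0 : 2 * D + 0 + 0 = 2 * D by lia.
  have [b [P [PS lP tP]]] := step (2 * D) (fun=> 0) [set k | 0 < k]
    (fun=> leq0n D) D2 a0 (often_dense_positives _) (fun b => tower0 c b _).
  by exists b, P; split.
elim: N a S => [//|N IHN] a S aD _ aN lS tS.
have [[b ab]|nab] := pselect (exists b, a b = D).
  exists b, S; split=> //; last by rewrite -ab.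
  by move=> n0; have [n n0n le] := lS n0; exists n => //; nia.
have {nab}aD' b : a b < D.
  by rewrite ltn_neqAle aD andbT; apply: contra_notN nab => /eqP; exists b.
have N0 : 0 < N by have := aD' true; have := aD' false; lia.
have Sinf : infinite_set S by exact: often_dense_infinite lS.
(* The free filter generated by S, to be refined to an ultrafilter. *)
have Soo : ProperFilter (within S \oo).
  apply: Build_ProperFilter_ex => A [n _ nA].
  apply: contrapT => nAx; apply: Sinf.
  apply: (sub_finite_set _ (finite_II n)) => x Sx /=.
  by rewrite ltnNge; apply/negP => nx; apply: nAx; exists x; apply: nA.
have [U [UU sU]] := ultraFilterLemma Soo.
have Uoo : \oo `<=` U.
  by move=> A Aoo; apply: sU; apply: filterS Aoo => x Ax _.
have US : U S by apply: sU; rewrite /within/=; exact: nearW.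
pose St b := S `&` [set v | U [set w | c v w = b]].
have Scover b : S `<=` St b `|` St (~~ b).
  move=> v Sv; have [Ub|Ub] := in_ultra_setVsetC [set w | c v w = b] UU.
    by left.
  right; split=> //=; apply: filterS Ub => w /=.
  by case: (c v w); case: b.
have [b Ub] : exists b, U (St b).
  have [Ut|Ut] := in_ultra_setVsetC (St true) UU; first by exists true.
  exists false; apply: filterS2 US Ut => v Sv /= nv.
  by have [] := Scover true v Sv.
have : often_dense (2 * D) (1 + N) (St b `|` St (~~ b)).
  move=> n0; have [n n0n le] := lS n0; exists n => //.
  apply: leq_trans le _; rewrite leq_mul2l; apply/orP; right.
  by apply: sub_count => k /asboolP/(Scover b) h; exact/asboolP.
move=> /often_denseU[lb|lb].
  exists b, (St b); split=> //; first by move=> x [].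
  by apply: (@const_tower _ _ _ _ U) => // v [].
(* The rest of the density then lies in the complementary part, over which the
   tower of the other colour grows by one level. *)
pose a' b' := if b' == b then a b' else (a b').+1.
have a'D b' : a' b' <= D by rewrite /a'; case: ifP => // _; exact: ltnW.
have a'N : N + a' true + a' false = 2 * D.
  by move: aN; rewrite /a'; case: (b) => /=; lia.
have tSt b' : tower c b' (a' b') (St (~~ b)).
  rewrite /a'; case: (eqVneq b' b) => [_|b'b].
    by apply: sub_tower (tS b') => x [].
  have -> : b' = ~~ b by move: b'b; case: b'; case: (b).
  by apply: (@towerS _ _ _ S _ U) => // [x []|x []].
have [b' [P [PS lP tP]]] := IHN a' (St (~~ b)) a'D N0 a'N lb tSt.
by exists b', P; split=> // x /PS[].
Qed.

Lemma upper_density_ge (R : realType) q (P S : set nat) :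
  0 < q -> P `<=` S -> often_dense q 1 P ->
  ((1 / q%:R : R)%R%:E <= upper_density R S)%E.
Proof.
move=> q0 PS lP; apply: le_ereal_inf_tmp => _ [V [m _ mV] <-].
have [n mn nP] := lP m.
apply: le_trans (ereal_sup_ubound _); last first.
  by exists n; [apply: mV; exact: ltnW|reflexivity].
set A := S `&` _.
have Afin : finite_set A.
  apply: (sub_finite_set _ (finite_II n.+1)) => k [_ /= /andP[_]].
  by rewrite ltnS.
have countA : initial_count P n <= #|` fset_set A|.
  rewrite /initial_count -size_filter; apply: uniq_leq_size.
    exact/filter_uniq/iota_uniq.
  move=> k; rewrite mem_filter mem_iota => /andP[/asboolP Pk kn].
  by rewrite in_fset_set//; apply/mem_set; split; [exact: PS|rewrite /=; lia].
have n0 : 0 < n by exact: leq_ltn_trans mn.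
rewrite lee_fin ler_pdivrMr ?ltr0n// mulrAC ler_pdivlMr ?ltr0n// mul1r.
rewrite -natrM ler_nat mulnC; apply: leq_trans (leq_mul (leqnn q) countA).
by rewrite mul1n in nP.
Qed.

(** * Transfer to the given graph *)

Lemma bounded_degree_neighbors (V : Type) (H : graph V) D (phi : V -> nat)
    (psi : nat -> V) :
  cancel phi psi -> cancel psi phi -> max_degree_le H D ->
  exists nb : nat -> seq nat, (forall x, size (nb x) <= D) /\
    forall x y, adj H (psi x) (psi y) <-> y \in nb x.
Proof.
move=> phiK psiK HD.
have /choice[nb nbP] : forall x, exists s : seq nat, size s <= D /\
    forall y, adj H (psi x) (psi y) <-> y \in s.
  move=> x; set A := [set y | adj H (psi x) (psi y)].
  have AD : A #<= `I_D.
    apply: card_le_trans (HD (psi x)).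
    rewrite (_ : A = phi @` [set y | adj H (psi x) y]) ?card_image_le//.
    apply/seteqP; split=> [y Ay|_ [y xy <-]]; first by exists (psi y).
    by rewrite /A /= phiK.
  have Afin : finite_set A by exact: card_le_finite AD (finite_II D).
  exists (fset_set A); split; first exact: geq_card_fset_set.
  by move=> y; rewrite in_fset_set//; split=> [Ay|/set_mem//]; exact/mem_set.
by exists nb; split=> x; have [] := nbP x.
Qed.

Theorem corollary2 (R : realType) (Delta : nat) (V : Type) (H : graph V)
    (Delta_gt0 : (0 < Delta)%N)
    (V_countable : countably_infinite V)
    (H_degree : max_degree_le H Delta) :
  (((1 / (2 * Delta%:R))%R : R)%:E <= ramsey_upper_density R H)%E.
Proof.
have [phi [psi phiK psiK]] : exists phi : V -> nat, bijective phi.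
  have /card_set_bijP[phi] := V_countable.
  by rewrite setTT_bijective; exists phi.
have [nb [nbD nbP]] := bounded_degree_neighbors phiK psiK H_degree.
apply: ereal_sup_ubound => c.
have [b [P [Ppos lP tP]]] := often_dense_tower c Delta_gt0.
have Pinf := often_dense_infinite (ltn0Sn 0) lP.
pose adjN x y := adj H (psi x) (psi y).
have adjNC x y : adjN x y -> adjN y x by exact: adj_sym.
have adjNI x : ~ adjN x x by exact: adj_irrefl.
have [f [f_inj f_pos Pf f_col]] :=
  @tower_covered_by_copy c b adjN nb Delta P nbP nbD adjNC adjNI Pinf Ppos tP.
pose g v := f (phi v).
have g_inj : injective g by move=> v w /f_inj; exact: can_inj phiK _ _.
pose E m n := exists v w, [/\ g v = m, g w = n & adj H v w].
have gt0 m : range g m -> 0 < m by case=> v _ <-; exact: f_pos.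
have EC m n : E m n -> E n m.
  by case=> v [w [vm wn vw]]; exists w, v; split=> //; exact: adj_sym.
have EI m : ~ E m m by case=> v [w [<- /g_inj wv]]; rewrite wv; exact: adj_irrefl.
have Eg m n : E m n -> range g m /\ range g n.
  by case=> v [w [<- <- _]]; split; [exists v|exists w].
exists (SubgraphKN gt0 EC EI Eg); split.
- exists b => _ _ /= [v [w [<- <- vw]]].
  by apply: f_col; rewrite /adjN !phiK.
- exists g; split=> /=.
    split=> [v _|v w _ _ /g_inj //|m [v _ <-]]; by exists v.
  by move=> v w; split=> [vw|[v' [w' [/g_inj-> /g_inj-> //]]]]; exists v, w.
- rewrite /= -natrM; apply: upper_density_ge lP; first by rewrite muln_gt0.
  by move=> p /Pf[x _ <-]; exists (psi x) => //; rewrite /g psiK.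
Qed.
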